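(* Let $\Lambda\subset\mathbb{R}$ and $\Omega\subset\mathbb{R}^m$ be open, $m\ge 2$, and let $\mathcal{M}(2)=[\mathcal{R}_{p,q}]_{1\le p,q\le m}$ be the matrix operator (associated with a system of second order nonlinear ordinary differential equations) with $$\mathcal{R}_{p,p}=f_{p,p,0,1}\mathrm{D}_{0,1}+f_{p,p,1,1}\mathrm{D}_{1,1}+f_{p,p,2,1}\mathrm{D}_{2,1},\qquad \mathcal{R}_{p,q}=f_{p,q,0,1}\mathrm{D}_{0,1}+f_{p,q,1,1}\mathrm{D}_{1,1}\ \ (p\ne q),$$ where the coefficients $f_{p,q,k,h}=f_{p,q,k,h}(x,u^1,\dots,u^m)$ belong to $\mathcal{C}(\Lambda\times\Omega,\mathbb{R})$. A necessary and sufficient condition for $\mathcal{M}(2)$ to be decomposed into the form $\mathcal{M}(2)=\mathcal{N}_1(1)\cdot\mathcal{N}_2(1)$, where for $i=1,2$, $\mathcal{N}_i(1)=[\mathcal{T}_{i,p,q}]_{1\le p,q\le m}$ with $$\mathcal{T}_{i,p,p}=a_{i,p,p,0,1}\mathrm{D}_{0,1}+a_{i,p,p,1,1}\mathrm{D}_{1,1},\qquad \mathcal{T}_{i,p,q}=a_{i,p,q,0,1}\mathrm{D}_{0,1}\ \ (p\ne q),$$ with coefficients depending on $(x,u^1,\dots,u^m)$, $a_{1,p,q,k,h}\in\mathcal{C}(\Lambda\times\Omega,\mathbb{R})$ and $a_{2,p,q,k,h}\in\mathcal{C}^1(\Lambda\times\Omega,\mathbb{R})$, is that, for all $p\in\{1,\dots,m\}$,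 \begin{align*} f_{p,p,0,1}&=\sum_{l=1}^m a_{1,p,l,0,1}a_{2,l,p,0,1}+a_{1,p,p,1,1}\mathrm{D}_{1,1}(a_{2,p,p,0,1}),\\ f_{p,p,1,1}&=a_{1,p,p,0,1}a_{2,p,p,1,1}+a_{1,p,p,1,1}a_{2,p,p,0,1}+a_{1,p,p,1,1}\mathrm{D}_{1,1}(a_{2,p,p,1,1})+a_{1,p,p,1,1}\mathrm{D}_{1,p+1}(a_{2,p,p,0,1})\,u^p,\\ f_{p,p,2,1}&=a_{1,p,p,1,1}a_{2,p,p,1,1},\\ 0&=\mathrm{D}_{1,\tilde h+1}(a_{2,p,p,0,1}),\quad \tilde h\in\{1,2,\dots,m\}\setminus\{p\},\\ 0&=\mathrm{D}_{1,\tilde h+1}(a_{2,p,p,1,1}),\quad \tilde h=1,2,\dots,m, \end{align*} and for all $p\ne q$ in $\{1,\dots,m\}$, \begin{align*} f_{p,q,0,1}&=\sum_{l=1}^m a_{1,p,l,0,1}a_{2,l,q,0,1}+a_{1,p,p,1,1}\mathrm{D}_{1,1}(a_{2,p,q,0,1}),\\ f_{p,q,1,1}&=a_{1,p,p,1,1}a_{2,p,q,0,1}+a_{1,p,q,0,1}a_{2,q,q,1,1}+a_{1,p,p,1,1}\mathrm{D}_{1,q+1}(a_{2,p,q,0,1})\,u^q,\\ 0&=\mathrm{D}_{1,\tilde h+1}(a_{2,p,q,0,1}),\quad \tilde h\in\{1,2,\dots,m\}\setminus\{q\}. \end{align*}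
   Context: For a scalar function $w=w(x)$ of one real variable: $\mathrm{D}_{0,1}w=w$, $\mathrm{D}_{1,1}w=w_x$, $\mathrm{D}_{2,1}w=\frac{d^2w}{dx^2}$. For a function $a(x,u^1,\dots,u^m)$ on $\Lambda\times\Omega$, regarded as a function of $m+1$ independent variables, $\mathrm{D}_{1,1}(a)=\partial a/\partial x$ and $\mathrm{D}_{1,\tilde h+1}(a)=\partial a/\partial u^{\tilde h}$ for $\tilde h=1,\dots,m$. Matrix operators act on $u={}^t(u^1,\dots,u^m)\in\mathcal{C}^2(\Lambda_0,\Omega)$, $\Lambda_0\subset\Lambda$ open, by $\mathcal{M}(2)u=\big[\sum_{q=1}^m\mathcal{R}_{p,q}u^q\big]_{1\le p\le m}$, all coefficients (of $\mathcal{M}(2)$, $\mathcal{N}_1(1)$ and $\mathcal{N}_2(1)$) being evaluated at $(x,u^1(x),\dots,u^m(x))$ for the original function $u$. The product is the matrix product with composition of entries: the $(p,q)$ entry of $\mathcal{N}_1(1)\cdot\mathcal{N}_2(1)$ is $\widetilde{\mathcal{R}}_{p,q}=\sum_{l=1}^m\mathcal{T}_{1,p,l}\mathcal{T}_{2,l,q}$, where $\widetilde{\mathcal{R}}_{p,q}u^q$ is obtained by applying to $u^q$ first $\mathcal{T}_{2,l,q}$ and then $\mathcal{T}_{1,p,l}$ (total $x$-derivatives being taken along $u(x)$). The equality $\mathcal{M}(2)=\mathcal{N}_1(1)\cdot\mathcal{N}_2(1)$ is an identity of matrix operators, obtained by identifying $\mathcal{R}_{p,q}u^q$ with $\widetilde{\mathcal{R}}_{p,q}u^q$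 for all $1\le p,q\le m$.
   Formalization: Necessity is proved only when the a_{1,p,p,1,1} (for given coefficients), or the f_{p,p,2,1} (for existence of a decomposition), vanish identically on no nonempty open subset of Λ×Ω; it fails otherwise, e.g. N_1=0, M=0, with N_2 depending on u. *)

(* Defs.v *)
From HB Require Import structures.
From mathcomp Require Import all_boot all_order all_algebra.
From mathcomp Require Import all_classical all_reals all_analysis.

Set Implicit Arguments.
Unset Strict Implicit.
Unset Printing Implicit Defensive.

Import Order.TTheory GRing.Theory Num.Theory.
Import numFieldNormedType.Exports.

Local Open Scope classical_set_scope.
Local Open Scope ring_scope.

(** A point [(x, u)] of [Lambda `*` Omega] gathers the [m + 1] independent
    variables [x, u^1, ..., u^m]; [u^p] is [z.2 0 p]. *)
Notation xuspace R m := (R * 'rV[R]_m)%type.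

(** Families of functions of [(x, u)], where [a p q k] is the coefficient
    of the [k]-th derivative [D_{k,1}] in the [(p, q)] entry of a matrix operator. *)
Notation coeffs R m := ('I_m -> 'I_m -> nat -> xuspace R m -> R).

Section Regularity.
Variables (R : realType) (m : nat).
Implicit Types (D : set (xuspace R m)) (a : xuspace R m -> R).

(* Meant for [D] open, where continuity at the points of [D] does not depend on
   the values outside [D]; the same holds for [class_C1]. *)
Definition class_C0 D a : Prop := forall z, D z -> {for z, continuous a}.

Definition class_C1 D a : Prop :=
  forall z, D z ->
    differentiable a z /\
    forall v : xuspace R m, {for z, continuous (fun y => 'D_v a y)}.

(** [u \in C^2(Lambda0, Omega)]; only the restriction of [u] to the open set
    [Lambda0] matters. *)
Definition class_C2_curve (Lambda0 : set R) (Omega : set 'rV[R]_m)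
    (u : R -> 'rV[R]_m) : Prop :=
  forall x, Lambda0 x ->
    Omega (u x) /\
    forall q : 'I_m, let uq := fun y => u y 0 q in
      [/\ derivable uq x 1, derivable (derive1 uq) x 1 &
          {for x, continuous (derive1n 2 uq)}].

(** [D_{1,1} a = da/dx] and [D_{1,h+1} a = da/du^h]. *)
Definition dx a (z : xuspace R m) : R := 'D_(1, 0) a z.
Definition du (h : 'I_m) a (z : xuspace R m) : R := 'D_(0, delta_mx 0 h) a z.

End Regularity.

Section Operators.
Variables (R : realType) (m : nat).
Implicit Types (c : nat -> xuspace R m -> R) (a f : coeffs R m).

(** In an operator [M(n)] the diagonal entries have terms up to order [n], the
    other entries up to order [n - 1]; coefficients beyond these are ignored. *)
Definition entry_order (n : nat) (p q : 'I_m) : nat :=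
  if p == q then n else n.-1.

Definition coeffs_in (P : (xuspace R m -> R) -> Prop) (n : nat) a : Prop :=
  forall p q k, (k <= entry_order n p q)%N -> P (a p q k).

(** [\sum_(k <= d) c_k D_{k,1}] applied to [w], the coefficients being taken
    along the curve [u]. *)
Definition scalar_op (d : nat) c (u : R -> 'rV[R]_m) (w : R -> R) : R -> R :=
  fun x => \sum_(k < d.+1) c k (x, u x) * derive1n k w x.

Definition entry (n : nat) a (p q : 'I_m) (u : R -> 'rV[R]_m) (w : R -> R) :
    R -> R :=
  scalar_op (entry_order n p q) (a p q) u w.

Definition entry_mul a1 a2 (p q : 'I_m) (u : R -> 'rV[R]_m) (w : R -> R) :
    R -> R :=
  fun x => \sum_(l < m) entry 1 a1 p l u (entry 1 a2 l q u w) x.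

(** [M(2) = N_1(1) N_2(1)]. *)
Definition decomposes (Lambda : set R) (Omega : set 'rV[R]_m) f a1 a2 : Prop :=
  forall (Lambda0 : set R) (u : R -> 'rV[R]_m),
    open Lambda0 -> Lambda0 `<=` Lambda -> class_C2_curve Lambda0 Omega u ->
    forall (p q : 'I_m) (x : R), Lambda0 x ->
      let uq := fun y => u y 0 q in
      entry 2 f p q u uq x = entry_mul a1 a2 p q u uq x.

Definition diag_conditions f a1 a2 (p : 'I_m) (z : xuspace R m) : Prop :=
  [/\ f p p 0%N z = \sum_(l < m) a1 p l 0%N z * a2 l p 0%N z
                    + a1 p p 1%N z * dx (a2 p p 0%N) z,
      f p p 1%N z = a1 p p 0%N z * a2 p p 1%N z
                    + a1 p p 1%N z * a2 p p 0%N z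
                    + a1 p p 1%N z * dx (a2 p p 1%N) z
                    + a1 p p 1%N z * du p (a2 p p 0%N) z * z.2 0 p,
      f p p 2%N z = a1 p p 1%N z * a2 p p 1%N z,
      (forall h : 'I_m, h != p -> 0 = du h (a2 p p 0%N) z) &
      (forall h : 'I_m, 0 = du h (a2 p p 1%N) z)].

Definition offdiag_conditions f a1 a2 (p q : 'I_m) (z : xuspace R m) : Prop :=
  [/\ f p q 0%N z = \sum_(l < m) a1 p l 0%N z * a2 l q 0%N z
                    + a1 p p 1%N z * dx (a2 p q 0%N) z,
      f p q 1%N z = a1 p p 1%N z * a2 p q 0%N z
                    + a1 p q 0%N z * a2 q q 1%N z
                    + a1 p p 1%N z * du q (a2 p q 0%N) z * z.2 0 q &
      (forall h : 'I_m, h != q -> 0 = du h (a2 p q 0%N) z)].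

Definition conditions (D : set (xuspace R m)) f a1 a2 : Prop :=
  forall z, D z ->
    (forall p, diag_conditions f a1 a2 p z) /\
    (forall p q, p != q -> offdiag_conditions f a1 a2 p q z).

(** The operator is genuinely of order [n]: no leading coefficient [a p p n]
    vanishes identically on a nonempty open part of [D]. If [a1 p p 1] does vanish
    on such a part, the composition puts no constraint there on the derivatives of
    the coefficients of [a2] (take [a1 = 0], [f = 0] and any [a2]). *)
Definition genuine_order (D : set (xuspace R m)) (n : nat) a : Prop :=
  forall p : 'I_m, D `<=` closure [set z | D z /\ a p p n z != 0].

End Operators.

(* Main.v *)
Require Import Defs.
From mathcomp Require Import all_boot all_order all_algebra.
From mathcomp Require Import all_classical all_reals all_analysis.
From mathcomp Require Import ring lra.
Import Order.TTheory GRing.Theory Num.Theory.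
Import numFieldNormedType.Exports.
Local Open Scope classical_set_scope.
Local Open Scope ring_scope.

(** Fix an entry [(p, q)], and let [b] and [c] be the coefficients of order 0
    and 1 of the [(p, q)] entry of [N_2] (so [c = 0] off the diagonal).  Only the
    diagonal entry [(p, p)] of [N_1] differentiates, so the product applied to
    [u^q] is a combination of [u^q] and [(u^q)'] with coefficients evaluated at
    [z = (x, u x)], plus [a1 p p 1 z] times the [x]-derivative of
    [b (x, u) u^q + c (x, u) (u^q)'].  By the chain rule, the difference between
    the two sides of [M(2) = N_1(1) N_2(1)] is therefore a polynomial in
    [v = u'] and in [w = (u^q)''], of degree 2, with coefficients depending on
    [z]; this is [defect_jet], computed in [entry_sub_entry_mul].  The stated
    conditions make all these coefficients vanish, so they are sufficient.

    Conversely, a curve of degree 2 through [z] has arbitrary first and second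
    derivatives there ([exists_curve_with_jet]), so the polynomial vanishes
    identically, and so do its coefficients ([defect_jet_eq0]).  These
    coefficients are the wanted ones up to two kinds of factors: the terms of
    order 0 carry the factor [u^q], and the derivatives of [b] and [c] with
    respect to the [u^h] carry the factor [a1 p p 1].  The first one is nonzero
    on a dense part of the open domain, the second one by genuineness of the
    order of [N_1]; the factors are cancelled there, and the remaining
    equalities extend by continuity ([closure_eq0]).

    Finally, the coefficient of [w] is cancelled by no factor: it gives
    [f p p 2 = a1 p p 1 * a2 p p 1] at every point, so that [N_1] is genuinely
    of order 1 as soon as [M] is genuinely of order 2 ([genuine_order_left]). *)

(** * Topology of the domain *)

Lemma open_setX (S T : topologicalType) (A : set S) (B : set T) :
  open A -> open B -> open (A `*` B).
Proof.
move=> oA oB; apply: openI; apply: open_comp => // x _.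
  exact: cvg_fst.
exact: cvg_snd.
Qed.

Lemma closure_eq0 (R : realType) (T : topologicalType) (g : T -> R)
    (S : set T) (z : T) :
  {for z, continuous g} -> closure S z -> (forall y, S y -> g y = 0) ->
  g z = 0.
Proof.
move=> gz Sz g0; apply/eqP/negPn/negP => gz0.
have /Sz[y [Sy /=]] : nbhs z (g @^-1` [set t | t != 0]).
  by apply: gz; apply: open_nbhs_nbhs; split=> //; exact: open_neq.
by rewrite g0 // eqxx.
Qed.

(** Moving [z] slightly along the axis of [u^q] makes this coordinate nonzero. *)
Lemma closure_coord_neq0 (R : realType) (m : nat) (D : set (xuspace R m))
    (q : 'I_m) (z : xuspace R m) :
  open D -> D z -> closure [set y | D y /\ y.2 0 q != 0] z.
Proof.
move=> oD Dz B Bz; have [zq|zq] := eqVneq (z.2 0 q) 0; last first.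
  by exists z; split; [|exact: nbhs_singleton].
pose g (t : R) : xuspace R m := (z.1, z.2 + t *: delta_mx 0 q).
have g0 : g t @[t --> 0^'] --> z.
  apply: cvg_within_filter.
  have -> : z = g 0 by rewrite /g scale0r addr0 -surjective_pairing.
  apply: differentiable_continuous; apply: differentiable_pair.
    exact: differentiable_cst.
  apply: differentiableD; first exact: differentiable_cst.
  exact: differentiableZl.
have Dn : nbhs z D by exact: open_nbhs_nbhs.
have DB : (0 : R)^' (g @^-1` (D `&` B)) by apply: g0; exact: filterI.
have [t [[Dt Bt] t0]] := filter_ex (filterI DB (nbhs_dnbhs_neq (0 : R))).
exists (g t); split=> //; split=> //.
by rewrite /= !mxE zq !eqxx add0r mulr1.
Qed.

Section Curves.
Context {R : realType} {m : nat}.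
Implicit Types (a f : coeffs R m) (u : R -> 'rV[R]_m) (D : set (xuspace R m)).
Implicit Types (z : xuspace R m).

(** * Derivatives along a curve *)

(** The chain rule, with the differential of [b] expanded on the canonical
    basis of the space of the [(x, u)]. *)
Lemma is_derive_along_curve (b : xuspace R m -> R) u (x : R) :
  differentiable b (x, u x) ->
  (forall q : 'I_m, derivable (fun y => u y 0 q) x 1) ->
  is_derive x 1 (fun y => b (y, u y))
    (dx b (x, u x)
     + \sum_(h < m) du h b (x, u x) * derive1 (fun y => u y 0 h) x).
Proof.
move=> db duq.
have Du : derivable u x 1.
  by apply/derivable_mxP => i q; rewrite ord1; exact: duq.
have du' : differentiable u x by apply/derivable1_diffP.
have dg : differentiable (fun y => (y, u y)) x by exact: differentiable_pair.
have dbg : differentiable (b \o (fun y => (y, u y))) x.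
  exact: differentiable_comp.
apply: DeriveDef; first exact/derivable1_diffP.
rewrite -[LHS]/('D_1 (b \o (fun y => (y, u y))) x) (deriveE _ dbg).
rewrite diff_comp //= diff_pair //= diff_val -(deriveE _ du') derive_mx //.
rewrite /dx /du deriveE //.
set v := \matrix_(_, _) _.
have -> : (1, v) =
    (1, 0) + \sum_(h < m) v 0 h *: ((0, delta_mx 0 h) : xuspace R m).
  rewrite {1}(row_sum_delta v).
  have -> : \sum_(h < m) v 0 h *: ((0, delta_mx 0 h) : xuspace R m) =
    (0, \sum_(h < m) v 0 h *: delta_mx 0 h).
    apply: (big_rec2 (fun s t => s = (0, t))) => [//|h s t _ ->].
    by congr pair; rewrite /= ?scaler0 ?addr0.
  by congr pair; rewrite /= ?addr0 ?add0r.
rewrite linearD linear_sum; congr (_ + _); apply: eq_bigr => h _.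
by rewrite linearZ /= -deriveE // mxE derive1E mulrC.
Qed.

(** The term [du q b * v q * u^q] joins the coefficient of [v q]; the other
    derivatives of [b] are left apart, since they multiply [v h] for [h != q]
    and nothing else can compensate them. *)
Lemma is_derive_first_order (b c : xuspace R m -> R) u (q : 'I_m) (x : R) :
  let z := (x, u x) in
  let v h := derive1 (fun y => u y 0 h) x in
  differentiable b z -> differentiable c z ->
  (forall h, derivable (fun y => u y 0 h) x 1) ->
  derivable (derive1 (fun y => u y 0 q)) x 1 ->
  is_derive x 1
    (fun y => b (y, u y) * u y 0 q + c (y, u y) * derive1 (fun y => u y 0 q) y)
    (dx b z * u x 0 q + (b z + dx c z + du q b z * u x 0 q) * v q
     + c z * derive1n 2 (fun y => u y 0 q) x
     + (\sum_(h < m | h != q) du h b z * v h) * u x 0 q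
     + (\sum_(h < m) du h c z * v h) * v q).
Proof.
move=> z v db dc du1 du2.
have hb := is_derive_along_curve b u x db du1.
have hc := is_derive_along_curve c u x dc du1.
have hq : is_derive x 1 (fun y => u y 0 q) (v q).
  by rewrite /v derive1E; exact/derivableP/du1.
have hq' : is_derive x 1 (derive1 (fun y => u y 0 q))
    (derive1n 2 (fun y => u y 0 q) x).
  by rewrite derive1nS derive1E; exact/derivableP/du2.
apply: (is_derive_eq (is_deriveD (is_deriveM hb hq) (is_deriveM hc hq'))).
rewrite /GRing.scale /= -/z (bigD1 q) //= -/(v q).
rewrite -[\sum_(i < m | i != q) _]/(\sum_(i < m | i != q) du i b z * v i).
rewrite -[\sum_(i < m) _]/(\sum_(i < m) du i c z * v i).
ring.
Qed.

(** The curve is the quadratic Taylor polynomial with the given jet, restricted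
    to the open set where it stays in [Omega]. *)
Lemma exists_curve_with_jet (Lambda : set R) (Omega : set 'rV[R]_m) z
    (v w : 'I_m -> R) :
  open Lambda -> open Omega -> (Lambda `*` Omega) z ->
  exists (Lambda0 : set R) u,
    [/\ open Lambda0, Lambda0 `<=` Lambda & class_C2_curve Lambda0 Omega u] /\
    [/\ Lambda0 z.1, u z.1 = z.2,
        (fun q => derive1 (fun y => u y 0 q) z.1) = v &
        (forall q, derive1n 2 (fun y => u y 0 q) z.1 = w q)].
Proof.
move=> oL oO [Lz Oz].
pose P q : {poly R} := (z.2 0 q)%:P + v q *: ('X - z.1%:P)
  + (w q / 2) *: (('X - z.1%:P) * ('X - z.1%:P)).
pose u y : 'rV[R]_m := \row_q (P q).[y].
have PE := (hornerXsubC, hornerD, hornerZ, hornerM, hornerC).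
have uE q : (fun y => u y 0 q) = horner (P q).
  by apply/funext => y; rewrite mxE.
have u' q : derive1 (fun y => u y 0 q) = horner (P q)^`().
  by rewrite uE -derivE.
have u'' q : derive1n 2 (fun y => u y 0 q) = horner (P q)^`()^`().
  by rewrite derive1nS derive1n1 u' -derivE.
have cu : continuous u.
  move=> y; have Du : derivable u y 1.
    by apply/derivable_mxP => i q; rewrite ord1 uE; exact: derivable_horner.
  by apply: differentiable_continuous; apply/derivable1_diffP.
have uz : u z.1 = z.2.
  by apply/rowP => q; rewrite mxE /P !PE subrr; ring.
exists (Lambda `&` u @^-1` Omega), u; split; split=> //.
- by apply: openI => //; move/continuousP: cu; exact.
- move=> x [Lx Ox]; split=> // q uq; rewrite /uq u' u'' uE; split.
  + exact: derivable_horner.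
  + exact: derivable_horner.
  + exact: continuous_horner.
- by split=> //; rewrite /preimage /= uz.
- by apply/funext => q; rewrite u' /P !poly.derivE !PE; ring.
- by move=> q; rewrite u'' /P !poly.derivE !PE; field.
Qed.

(** * The difference between the two operators *)

(** The coefficient of order [n] in the [(p, q)] entry of an operator [M(n)],
    with the value 0 off the diagonal, where [a p q n] is meaningless. It allows
    diagonal and off-diagonal entries to be treated alike. *)
Definition leading_coef (n : nat) a (p q : 'I_m) : xuspace R m -> R :=
  if p == q then a p q n else cst 0.

Lemma entry1E a p q u w : entry 1 a p q u w =
  fun x => a p q 0%N (x, u x) * w x
           + leading_coef 1 a p q (x, u x) * derive1 w x.
Proof.
apply/funext => x; rewrite /entry /scalar_op /entry_order /leading_coef.
by case: eqP => _; rewrite !big_ord_recl big_ord0 /= ?addr0 ?mul0r ?addr0.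
Qed.

Lemma entry2E a p q u w x : entry 2 a p q u w x =
  a p q 0%N (x, u x) * w x + a p q 1%N (x, u x) * derive1 w x
  + leading_coef 2 a p q (x, u x) * derive1n 2 w x.
Proof.
rewrite /entry /scalar_op /entry_order /leading_coef.
by case: eqP => _; rewrite !big_ord_recl big_ord0 /= ?addr0 ?mul0r ?addr0 ?addrA.
Qed.

Lemma leading_coef_differentiable D a p q z :
  coeffs_in (class_C1 D) 1 a -> D z -> differentiable (leading_coef 1 a p q) z.
Proof.
rewrite /leading_coef => aC1 Dz.
case: eqVneq => [->|_]; last exact: differentiable_cst.
by apply: (aC1 _ _ _ _ z Dz).1; rewrite /entry_order eqxx.
Qed.

Lemma leading_coef_continuous_derive D a p q v :
  coeffs_in (class_C1 D) 1 a ->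
  class_C0 D (fun y => 'D_v (leading_coef 1 a p q) y).
Proof.
rewrite /leading_coef => aC1 z Dz; case: eqVneq => [->|_].
  by apply: (aC1 _ _ _ _ z Dz).2; rewrite /entry_order eqxx.
have -> : (fun y => 'D_v (cst 0 : xuspace R m -> R) y) = cst 0.
  by apply/funext => y; exact: derive_cst.
exact: cst_continuous.
Qed.

Definition defect0 f a1 a2 p q z : R :=
  f p q 0%N z - (\sum_(l < m) a1 p l 0%N z * a2 l q 0%N z
                 + a1 p p 1%N z * dx (a2 p q 0%N) z).

Definition defect1 f a1 a2 p q z : R :=
  f p q 1%N z - (a1 p p 1%N z * a2 p q 0%N z + a1 p q 0%N z * a2 q q 1%N z
                 + a1 p p 1%N z * dx (leading_coef 1 a2 p q) z
                 + a1 p p 1%N z * du q (a2 p q 0%N) z * z.2 0 q).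

Definition defect2 f a1 a2 p q z : R :=
  leading_coef 2 f p q z - a1 p p 1%N z * leading_coef 1 a2 p q z.

(** The difference [M(2) - N_1(1) N_2(1)], as a function of the jet
    [(z, v, w)] of a curve, where [v = u'] and [w = (u^q)'']. *)
Definition defect_jet f a1 a2 p q z (v : 'I_m -> R) (w : R) : R :=
  defect0 f a1 a2 p q z * z.2 0 q + defect1 f a1 a2 p q z * v q
  + defect2 f a1 a2 p q z * w
  - a1 p p 1%N z * ((\sum_(h < m | h != q) du h (a2 p q 0%N) z * v h) * z.2 0 q
                    + (\sum_(h < m) du h (leading_coef 1 a2 p q) z * v h) * v q).

Definition entry_conditions f a1 a2 p q z : Prop :=
  [/\ defect0 f a1 a2 p q z = 0, defect1 f a1 a2 p q z = 0,
      defect2 f a1 a2 p q z = 0,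
      (forall h, h != q -> du h (a2 p q 0%N) z = 0) &
      (forall h, du h (leading_coef 1 a2 p q) z = 0)].

Lemma dx_cst0 z : dx (cst 0 : xuspace R m -> R) z = 0.
Proof. exact: derive_cst. Qed.

Lemma du_cst0 h z : du h (cst 0 : xuspace R m -> R) z = 0.
Proof. exact: derive_cst. Qed.

Lemma conditionsP D f a1 a2 : conditions D f a1 a2 <->
  forall z, D z -> forall p q, entry_conditions f a1 a2 p q z.
Proof.
rewrite /entry_conditions /defect0 /defect1 /defect2 /leading_coef.
split=> [H z /H[diag off] p q|H z Dz].
- have [<-{q}|pq] := eqVneq p q.
    have [-> -> -> b0 c0] := diag p.
    by split=> [|||h /b0 ->|h]; rewrite ?subrr//; ring.
  have [-> -> b0] := off _ _ pq.
  by split=> [|||h /b0 ->|h]; rewrite ?subrr ?dx_cst0 ?du_cst0 //=; ring.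
- split=> [p|p q pq].
    have := H _ Dz p p; rewrite /diag_conditions eqxx.
    move=> -[/subr0_eq -> /subr0_eq -> /subr0_eq -> b0 c0].
    by split=> [|||h /b0 ->|h] //; ring.
  have := H _ Dz p q; rewrite /offdiag_conditions (negPf pq) dx_cst0.
  move=> -[/subr0_eq -> /subr0_eq -> _ b0 _].
  by split=> [||h /b0 ->] //; ring.
Qed.

Lemma entry_sub_entry_mul (Lambda0 : set R) (Omega : set 'rV[R]_m)
    f a1 a2 u p q x :
  coeffs_in (class_C1 (Lambda0 `*` Omega)) 1 a2 ->
  class_C2_curve Lambda0 Omega u -> Lambda0 x ->
  let uq := fun y => u y 0 q in
  entry 2 f p q u uq x - entry_mul a1 a2 p q u uq x =
  defect_jet f a1 a2 p q (x, u x) (fun h => derive1 (fun y => u y 0 h) x)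
    (derive1n 2 uq x).
Proof.
move=> a2C1 uC2 Lx uq; have [Ou hu] := uC2 _ Lx.
set z := (x, u x); set w := derive1n 2 uq x.
have Dz : (Lambda0 `*` Omega) z by split.
have db : differentiable (a2 p q 0%N) z by exact: (a2C1 _ _ _ _ z Dz).1.
have dc := leading_coef_differentiable _ _ p q _ a2C1 Dz.
have d1 h : derivable (fun y => u y 0 h) x 1.
  by case: (hu h) => + _ _; apply.
have d2 : derivable (derive1 uq) x 1.
  by case: (hu q) => _ + _; apply.
have [_ dE] := is_derive_first_order _ _ u q x db dc d1 d2.
pose g y := a2 p q 0%N (y, u y) * uq y
            + leading_coef 1 a2 p q (y, u y) * derive1 uq y.
have mulE : entry_mul a1 a2 p q u uq x =
    (\sum_(l < m) a1 p l 0%N z * a2 l q 0%N z) * uq x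
    + a1 p q 0%N z * a2 q q 1%N z * derive1 uq x + a1 p p 1%N z * derive1 g x.
  rewrite /entry_mul; under eq_bigr => l _ do rewrite !entry1E -/z.
  rewrite big_split /=; congr (_ + _).
    under eq_bigr => l _ do rewrite mulrDr !mulrA.
    rewrite big_split /= -!mulr_suml; congr (_ + _ * _).
    rewrite (bigD1 q) //= big1 ?addr0 /leading_coef ?eqxx // => l lq.
    by rewrite (negPf lq) mulr0.
  rewrite (bigD1 p) //= big1 ?addr0 /leading_coef ?eqxx // => l lp.
  by rewrite eq_sym (negPf lp) mul0r.
rewrite entry2E mulE [derive1 g x]derive1E dE -/z -/w.
rewrite /defect_jet /defect0 /defect1 /defect2 /=.
rewrite -[uq x]/(u x 0 q).
ring.
Qed.

(** * Vanishing of the coefficients *)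

Lemma sum_delta (P : pred 'I_m) (d : 'I_m -> R) (h : 'I_m) (t : R) :
  \sum_(i < m | P i) d i * (t *+ (i == h)) = (d h * t) *+ P h.
Proof.
have [Ph|Ph] := boolP (P h).
  rewrite (bigD1 h) //= eqxx big1 ?addr0 // => i /andP[_ /negPf ->].
  by rewrite mulr0n mulr0.
rewrite big1 ?mulr0n // => i Pi.
case: eqVneq => [ih|_]; last by rewrite mulr0n mulr0.
by rewrite -ih Pi in Ph.
Qed.

Lemma polynomial_eq0 (d0 d1 d2 A U b cq ch : R) :
  (forall s t w,
     d0 * U + d1 * s + d2 * w - A * (b * t * U + (cq * s + ch * t) * s) = 0) ->
  [/\ d0 * U = 0, d1 = 0, d2 = 0, A * b * U = 0 & A * cq = 0 /\ A * ch = 0].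
Proof.
move=> P.
have d0U : d0 * U = 0 by have := P 0 0 0; lra.
have d20 : d2 = 0 by have := P 0 0 1; lra.
have d10 : d1 = 0 by have := P 1 0 0; have := P (-1) 0 0; lra.
have Acq : A * cq = 0 by have := P 1 0 0; lra.
have AbU : A * b * U = 0 by have := P 0 1 0; lra.
by split=> //; split=> //; have := P 1 1 0; lra.
Qed.

(** Velocities supported by the axes [q] and [h] are enough to separate the
    coefficients, which reduces the claim to a polynomial in three variables. *)
Lemma defect_jet_eq0 f a1 a2 p q z :
  (forall v w, defect_jet f a1 a2 p q z v w = 0) ->
  [/\ defect0 f a1 a2 p q z * z.2 0 q = 0, defect1 f a1 a2 p q z = 0,
      defect2 f a1 a2 p q z = 0,
      (forall h, h != q -> a1 p p 1%N z * du h (a2 p q 0%N) z * z.2 0 q = 0) &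
      (forall h, a1 p p 1%N z * du h (leading_coef 1 a2 p q) z = 0)].
Proof.
rewrite /defect_jet => J.
have jet h s t w : h != q -> defect0 f a1 a2 p q z * z.2 0 q
    + defect1 f a1 a2 p q z * s + defect2 f a1 a2 p q z * w
  - a1 p p 1%N z * (du h (a2 p q 0%N) z * t * z.2 0 q
       + (du q (leading_coef 1 a2 p q) z * s
          + du h (leading_coef 1 a2 p q) z * t) * s) = 0.
  move=> hq; rewrite -(J (fun i => s *+ (i == q) + t *+ (i == h)) w).
  rewrite eqxx [q == h]eq_sym (negPf hq) mulr1n mulr0n addr0.
  congr (_ - _ * (_ * _ + _ * _)).
    under [RHS]eq_bigr => i _ do rewrite mulrDr.
    by rewrite big_split /= !sum_delta eqxx hq mulr0n add0r.
  under [RHS]eq_bigr => i _ do rewrite mulrDr.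
  by rewrite big_split /= !sum_delta.
(* The case [h = q] is kept apart, with null coefficients for the variable [t],
   as the velocity then has the single component [s]. *)
have jetq s (t : R) w : defect0 f a1 a2 p q z * z.2 0 q
    + defect1 f a1 a2 p q z * s + defect2 f a1 a2 p q z * w
  - a1 p p 1%N z * (0 * t * z.2 0 q
       + (du q (leading_coef 1 a2 p q) z * s + 0 * t) * s) = 0.
  rewrite -[RHS](J (fun i => s *+ (i == q)) w).
  rewrite !mul0r add0r addr0 eqxx mulr1n.
  by rewrite !sum_delta eqxx /= mulr0n mul0r add0r.
have [d0 d1 d2 _ [cq _]] := polynomial_eq0 _ _ _ _ _ _ _ _ jetq.
have poly h (hq : h != q) :=
  polynomial_eq0 _ _ _ _ _ _ _ _ (fun s t w => jet h s t w hq).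
split; [exact: d0|exact: d1|exact: d2|move=> h hq|move=> h].
  by have [_ _ _ + _] := poly h hq.
have [->|hq] := eqVneq h q; first exact: cq.
by have [_ _ _ _ [_ +]] := poly h hq.
Qed.

Lemma defect0_continuous D f a1 a2 p q :
  coeffs_in (class_C0 D) 2 f -> coeffs_in (class_C0 D) 1 a1 ->
  coeffs_in (class_C1 D) 1 a2 -> class_C0 D (defect0 f a1 a2 p q).
Proof.
move=> fC a1C a2C z Dz.
have ca2 l : {for z, continuous (a2 l q 0%N)}.
  by apply: differentiable_continuous; have [] := a2C l q 0%N isT z Dz.
apply: cvgB; first exact: (fC p q 0%N isT z Dz).
apply: cvgD.
  apply: cvg_big => [|l _]; first exact: add_continuous.
  by apply: cvgM; [exact: (a1C p l 0%N isT z Dz)|exact: ca2].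
apply: cvgM; last exact: (a2C p q 0%N isT z Dz).2.
by apply: (a1C p p 1%N _ z Dz); rewrite /entry_order eqxx.
Qed.

(** * Decompositions *)

Lemma coeffs_in_class_C1_sub D D' n a :
  D' `<=` D -> coeffs_in (class_C1 D) n a -> coeffs_in (class_C1 D') n a.
Proof. by move=> D'D aC p q k hk z /D'D; exact: aC. Qed.

Lemma decomposes_of_conditions (Lambda : set R) (Omega : set 'rV[R]_m) f a1 a2 :
  coeffs_in (class_C1 (Lambda `*` Omega)) 1 a2 ->
  conditions (Lambda `*` Omega) f a1 a2 -> decomposes Lambda Omega f a1 a2.
Proof.
move=> a2C1 /conditionsP H L0 u oL0 L0L uC2 p q x Lx uq; apply/eqP.
rewrite -subr_eq0; have [Ox _] := uC2 _ Lx.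
have a2C1' := coeffs_in_class_C1_sub _ _ _ _
  (setSX (@subset_refl _ Omega) L0L) a2C1.
rewrite (entry_sub_entry_mul _ _ _ _ _ _ _ _ _ a2C1' uC2 Lx) /defect_jet.
have [-> -> -> b0 c0] := H (x, u x) (conj (L0L _ Lx) Ox) p q.
rewrite big1 => [|h /b0 ->]; last by rewrite mul0r.
rewrite big1 => [|h _]; last by rewrite c0 mul0r.
by apply/eqP; ring.
Qed.

Lemma decomposes_defect_jet (Lambda : set R) (Omega : set 'rV[R]_m) f a1 a2 :
  open Lambda -> open Omega ->
  coeffs_in (class_C1 (Lambda `*` Omega)) 1 a2 ->
  decomposes Lambda Omega f a1 a2 ->
  forall z, (Lambda `*` Omega) z ->
  forall p q v w, defect_jet f a1 a2 p q z v w = 0.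
Proof.
move=> oL oO a2C1 H z Dz p q v w.
have [L0 [u [[oL0 L0L uC2] [Lz uz uv uw]]]] :=
  exists_curve_with_jet Lambda Omega z v (fun=> w) oL oO Dz.
have a2C1' := coeffs_in_class_C1_sub _ _ _ _
  (setSX (@subset_refl _ Omega) L0L) a2C1.
have := entry_sub_entry_mul _ _ f a1 _ _ p q _ a2C1' uC2 Lz.
cbv zeta; rewrite (H _ _ oL0 L0L uC2 p q _ Lz) subrr uv uw uz.
by rewrite -surjective_pairing => <-.
Qed.

Lemma genuine_order_left (Lambda : set R) (Omega : set 'rV[R]_m) f a1 a2 :
  open Lambda -> open Omega ->
  coeffs_in (class_C1 (Lambda `*` Omega)) 1 a2 ->
  decomposes Lambda Omega f a1 a2 ->
  genuine_order (Lambda `*` Omega) 2 f -> genuine_order (Lambda `*` Omega) 1 a1.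
Proof.
move=> oL oO a2C1 H fo p z Dz.
apply: (closureS _ (fo p z Dz)) => y [Dy fy]; split=> //.
have J := decomposes_defect_jet _ _ _ _ _ oL oO a2C1 H y Dy p p.
have [_ _ + _ _] := defect_jet_eq0 _ _ _ p p y J.
rewrite /defect2 /leading_coef eqxx => /subr0_eq fE.
by apply: contraNneq fy => a0; rewrite fE a0 mul0r.
Qed.

Lemma conditions_of_decomposes (Lambda : set R) (Omega : set 'rV[R]_m) f a1 a2 :
  open Lambda -> open Omega ->
  coeffs_in (class_C0 (Lambda `*` Omega)) 2 f ->
  coeffs_in (class_C0 (Lambda `*` Omega)) 1 a1 ->
  coeffs_in (class_C1 (Lambda `*` Omega)) 1 a2 ->
  genuine_order (Lambda `*` Omega) 1 a1 ->
  decomposes Lambda Omega f a1 a2 -> conditions (Lambda `*` Omega) f a1 a2.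
Proof.
set D := Lambda `*` Omega => oL oO fC a1C a2C1 a1o H.
apply/conditionsP => z Dz p q.
have oD : open D by exact: open_setX.
have J y (Dy : D y) := defect_jet_eq0 _ _ _ p q y
  (decomposes_defect_jet _ _ _ _ _ oL oO a2C1 H y Dy p q).
have [_ d1 d2 _ _] := J z Dz.
have a1pC y : D y -> {for y, continuous (a1 p p 1%N)}.
  by move=> Dy; apply: (a1C p p 1%N _ y Dy); rewrite /entry_order eqxx.
split=> // [|h hq|h].
- have d0C := defect0_continuous _ _ _ _ p q fC a1C a2C1 z Dz.
  apply: (closure_eq0 _ _ _ _ _ d0C (closure_coord_neq0 _ _ _ q _ oD Dz)).
  move=> y [Dy yq]; have [/eqP + _ _ _ _] := J y Dy.
  by rewrite mulf_eq0 (negPf yq) orbF => /eqP.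
- have bC y : D y -> {for y, continuous (du h (a2 p q 0%N))}.
    by move=> Dy; exact: (a2C1 p q 0%N isT y Dy).2.
  (* Cancelling the two factors one after the other, each on a dense set, avoids
     considering the density of the set where neither of them vanishes. *)
  apply: (closure_eq0 _ _ _ _ _ (bC z Dz) (a1o p z Dz)) => y [Dy ay].
  apply: (mulfI ay); rewrite mulr0.
  apply: (closure_eq0 _ _ (fun y => a1 p p 1%N y * du h (a2 p q 0%N) y) _ _ _
    (closure_coord_neq0 _ _ _ q _ oD Dy)).
    by apply: cvgM; [exact: a1pC|exact: bC].
  move=> t [Dt tq]; have [_ _ _ /(_ h hq)/eqP + _] := J t Dt.
  by rewrite mulf_eq0 (negPf tq) orbF => /eqP.
- have cC :=
    leading_coef_continuous_derive _ _ p q (0, delta_mx 0 h) a2C1 z Dz.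
  apply: (closure_eq0 _ _ _ _ _ cC (a1o p z Dz)) => y [Dy ay].
  by have [_ _ _ _ /(_ h)/eqP] := J y Dy; rewrite mulf_eq0 (negPf ay) => /eqP.
Qed.

End Curves.

Theorem proposition3p3 (R : realType) (m : nat) (hm : (2 <= m)%N)
    (Lambda : set R) (Omega : set 'rV[R]_m)
    (hLambda : open Lambda) (hOmega : open Omega)
    (f : coeffs R m) (hf : coeffs_in (class_C0 (Lambda `*` Omega)) 2 f) :
  (forall a1 a2 : coeffs R m,
     coeffs_in (class_C0 (Lambda `*` Omega)) 1 a1 ->
     coeffs_in (class_C1 (Lambda `*` Omega)) 1 a2 ->
     (conditions (Lambda `*` Omega) f a1 a2 ->
      decomposes Lambda Omega f a1 a2) /\
     (genuine_order (Lambda `*` Omega) 1 a1 ->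
      decomposes Lambda Omega f a1 a2 ->
      conditions (Lambda `*` Omega) f a1 a2)) /\
  (genuine_order (Lambda `*` Omega) 2 f ->
     ((exists a1 a2 : coeffs R m,
         [/\ coeffs_in (class_C0 (Lambda `*` Omega)) 1 a1,
             coeffs_in (class_C1 (Lambda `*` Omega)) 1 a2 &
             decomposes Lambda Omega f a1 a2]) <->
      (exists a1 a2 : coeffs R m,
         [/\ coeffs_in (class_C0 (Lambda `*` Omega)) 1 a1,
             coeffs_in (class_C1 (Lambda `*` Omega)) 1 a2 &
             conditions (Lambda `*` Omega) f a1 a2]))).
Proof.
split=> [a1 a2 a1C a2C|fo].
  split; first exact: decomposes_of_conditions.
  exact: conditions_of_decomposes.
split=> -[a1 [a2 [a1C a2C H]]]; exists a1, a2; split=> //.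
  apply: conditions_of_decomposes => //.
  exact: genuine_order_left hLambda hOmega a2C H fo.
exact: decomposes_of_conditions.
Qed.
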